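(* Let $\theta\ge 2$ be an integer, let $0\le k\le n$ be integers, and let $C_{n,k}^{(\theta)}$ be the containment level of the vertex labeled $k$ in a hyperrecursive tree of hyperedge size $\theta$ at age $n$. Then $$\mathbb{E}\big[C_{n,k}^{(\theta)}\big] = 1+(\theta-1)\big(H_n(\theta-1)-H_k(\theta-1)\big),$$ $$\mathrm{Var}\big[C_{n,k}^{(\theta)}\big] = (\theta-1)\big(H_n(\theta-1)-H_k(\theta-1)\big)-(\theta-1)^2\big(H_n^{(2)}(\theta-1)-H_k^{(2)}(\theta-1)\big).$$ Moreover, as $n\to\infty$: (a) if $k\ge 0$ is fixed, then $$\mathbb{E}\big[C_{n,k}^{(\theta)}\big]=(\theta-1)\Big(\ln(n)-\psi(\theta-1)-\frac{1}{\theta-1}\Big)+1-(\theta-1)H_k(\theta-1)+O\Big(\frac1n\Big),$$ $$\mathrm{Var}\big[C_{n,k}^{(\theta)}\big]=(\theta-1)\ln(n)+O(1);$$ (b) if $n\ge k\to\infty$, then $$\mathbb{E}\big[C_{n,k}^{(\theta)}\big]=(\theta-1)\ln\Big(\frac nk\Big)+1+O\Big(\frac1k\Big),\qquad \mathrm{Var}\big[C_{n,k}^{(\theta)}\big]=(\theta-1)\ln\Big(\frac nk\Big)+O\Big(\frac1k\Big).$$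
   Context: Hyperrecursive tree with hyperedge size $\theta$ (an integer $\theta\ge2$): at time $0$ there are $\theta$ originating vertices, all labeled $0$, which together form the first hyperedge. At each time $n\ge1$ a new vertex labeled $n$ is added; a subset of size $\theta-1$ of the $n-1+\theta$ existing vertices is chosen uniformly at random among all subsets of that size (independently of the past), and the new vertex together with the chosen vertices forms a new hyperedge. The structure at time $n$ (right after insertion of vertex $n$) is said to have age $n$; it has $n+\theta$ vertices. The containment level $C_{n,k}^{(\theta)}$ of vertex $k$ at time $n\ge k$ is the number of hyperedges containing vertex $k$ at time $n$; for $k=0$ one tracks a fixed chosen representative among the $\theta$ originators (all of which have identically distributed containment levels). Generalized harmonic numbers: $H_n^{(s)}(x)=\sum_{j=1}^n \frac{1}{(j+x)^s}$ for integer $n\ge0$ and real $s,x\ge0$, and $H_n(x)=H_n^{(1)}(x)$. The function $\psi$ is the digamma function. *)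

(* Defs.v *)
From HB Require Import structures.
From mathcomp Require Import all_boot all_order all_algebra.
From mathcomp Require Import all_classical all_reals all_analysis.

Set Implicit Arguments.
Unset Strict Implicit.
Unset Printing Implicit Defensive.

Import Order.TTheory GRing.Theory Num.Theory.
Import numFieldNormedType.Exports.

Local Open Scope classical_set_scope.
Local Open Scope ring_scope.

(* H_n^{(s)}(x) *)
Definition gen_harmonic (R : realType) (s : R) (n : nat) (x : R) : R :=
  \sum_(1 <= j < n.+1) ((j%:R + x) `^ s)^-1.

(* Euler's integral, meaningful for 0 < x *)
Definition Gamma (R : realType) (x : R) : R :=
  \int[lebesgue_measure]_(t in `]0, +oo[) (t `^ (x - 1) * expR (- t)).

Definition digamma (R : realType) (x : R) : R :=
  derive1 (@Gamma R) x / Gamma x.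

(* The n + theta vertices of the structure of age n are the elements of
   'I_(n + theta), in order of insertion: the originators are 0, ..., theta - 1
   and the vertex labeled k >= 1 is k - 1 + theta. *)

(* The vertex labeled k; o is the tracked representative among the
   originators. *)
Definition vertex (theta : nat) (o : 'I_theta) (k : nat) : nat :=
  if k is j.+1 then (j + theta)%N else o.

(* [S m] is the set of existing vertices chosen at time m + 1. *)
Definition hyperedge (theta : nat) (S : forall m, {set 'I_(m + theta)})
    (n : nat) : {set 'I_(n + theta)} :=
  match n with
  | 0%N => [set: 'I_(0 + theta)]%SET
  | m.+1 => (ord_max |: [set lift ord_max v | v in S m])%SET
  end.

(* Hyperedges are indexed by their time of insertion; the one inserted at time
   n is the first to contain its largest vertex, so they are all distinct. *)
Definition containment_level (theta : nat)
    (S : forall m, {set 'I_(m + theta)}) (o : 'I_theta) (n k : nat) : nat :=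
  #|[set j : 'I_n.+1 | [exists v in hyperedge S j, val v == vertex o k]]|.

Section process.
Context d (T : measurableType d) (R : realType) (P : probability T R).
Variables (theta : nat) (S : T -> forall m, {set 'I_(m + theta)}).

Definition choice_event (m : nat) (A : {set 'I_(m + theta)}) : set T :=
  [set w | S w m = A].

Definition past_event (m : nat) (h : forall i, {set 'I_(i + theta)}) : set T :=
  [set w | forall i, (i < m)%N -> S w i = h i].

Record hyperrecursive_tree : Prop := {
  choice_measurable : forall m A, measurable (@choice_event m A);
  choice_uniform : forall m (A : {set 'I_(m + theta)}),
    P (choice_event A) =
      (if #|A| == (theta - 1)%N then 'C(m + theta, theta - 1)%:R^-1 else 0)%:E;
  choice_indep : forall m h (A : {set 'I_(m + theta)}),
    P (past_event m h `&` choice_event A) =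
      (P (past_event m h) * P (choice_event A))%E
}.

End process.

(* C_{n,k} as a real random variable *)
Definition containment (R : realType) (T : Type) (theta : nat)
    (S : T -> forall m, {set 'I_(m + theta)}) (o : 'I_theta) (n k : nat) :
    T -> R :=
  fun w => (containment_level (S w) o n k)%:R.

(* The regime "n >= k, k --> oo" for pairs (n, k); n --> oo is then implied. *)
Definition n_ge_k_oo : set_system (nat * nat) :=
  within [set p | (p.2 <= p.1)%N] (filter_prod \oo \oo).

Instance n_ge_k_oo_filter : Filter n_ge_k_oo.
Proof. exact: within_filter. Qed.

Canonical n_ge_k_oo_filter_on := FilterType n_ge_k_oo n_ge_k_oo_filter.

(* Main.v *)
(* Conditionally on the first n choices, vertex k <= n belongs to the hyperedge
   of time n + 1 with probability t / (n + 1 + t), where t = theta - 1. Hence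
   C_{n,k} is 1 plus a sum of pairwise independent indicators, which gives the
   exact mean and variance.

   Comparing 1 / y with ln (y + 1) - ln y and ln y - ln (y - 1) gives the regime
   k --> oo. For fixed k one needs
   H_n(t) - ln n = - psi t - 1 / t + O(1 / n) for psi = Gamma' / Gamma. In the
   style of Bohr and Mollerup, Gamma (x + 1) = x Gamma x and
   Gamma (x + h) <= x^h Gamma x (0 <= h <= 1) squeeze the difference quotients
   of ln Gamma at x between ln (x + n) - O(1 / n) and ln (x + n), up to difference
   quotients of the ln (x + j), j < n. This shows at once that ln Gamma is
   derivable and that its derivative is ln (x + n) - \sum_(j < n) 1 / (x + j) up
   to O(1 / n), without differentiating under the integral sign. *)
Require Import Defs.
From HB Require Import structures.
From mathcomp Require Import all_boot all_order all_algebra.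
From mathcomp Require Import all_classical all_reals all_analysis.
From mathcomp Require Import measurable_realfun ring lra.

Set Implicit Arguments.
Unset Strict Implicit.
Unset Printing Implicit Defensive.

Import Order.TTheory GRing.Theory Num.Theory.
Import numFieldNormedType.Exports.

Local Open Scope classical_set_scope.
Local Open Scope ring_scope.

(** * Euler's integral: exhaustion by segments and integration by parts *)

Section euler_integral.
Context {R : realType}.
Notation mu := (@lebesgue_measure R).
Implicit Types (x a b : R).

Definition euler_integrand x (u : R) : R := u `^ (x - 1) * expR (- u).

Definition euler_integral x : \bar R :=
  (\int[mu]_(u in `]0%R, +oo[) (euler_integrand x u)%:E)%E.

Lemma euler_integrand_ge0 x u : 0 <= euler_integrand x u.
Proof. by rewrite mulr_ge0 ?powR_ge0 ?expR_ge0. Qed.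

Lemma measurable_euler_integrand x (D : set R) :
  measurable_fun D (euler_integrand x).
Proof.
apply: measurable_funTS; apply: measurable_funM.
  exact: measurable_powR.
by apply: measurableT_comp => //; exact: measurableT_comp.
Qed.

(** Rounding [x] up to a natural number [m], the term of degree [m.+1] of the exponential series
    bounds the expression by [m.+1]! / [n.+1]. This kills the boundary term at infinity. *)
Lemma powR_mulexpN_cvg0 x :
  (n.+1%:R `^ x * expR (- n.+1%:R) : R) @[n --> \oo] --> (0 : R).
Proof.
have [m xm] : exists m : nat, x <= m%:R.
  by exists (Num.bound `|x|); rewrite (le_trans (ler_norm _))// ltW// archi_boundP.
apply: (@squeeze_cvgr _ _ _ _ (fun=> 0) (fun n => m.+1`!%:R * n.+1%:R^-1)).
- near=> n; rewrite mulr_ge0 ?powR_ge0 ?expR_ge0//=.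
  rewrite expRN ler_pdivrMr ?expR_gt0//.
  have n0 : 0 < n.+1%:R :> R by rewrite ltr0n.
  apply: (@le_trans _ _ (n.+1%:R ^+ m)).
    by rewrite -powR_mulrn// ler_powR// ler1n.
  have /(le_trans _) := @expR_ge1Dxn R n.+1%:R m (ltW n0).
  move=> /(_ (n.+1%:R ^+ m.+1 / m.+1`!%:R)) h.
  have {}h : n.+1%:R ^+ m.+1 / m.+1`!%:R <= expR n.+1%:R :> R.
    by apply: h; rewrite lerDr.
  have f0 : 0 < m.+1`!%:R :> R by rewrite ltr0n fact_gt0.
  rewrite mulrAC ler_pdivlMr// -exprSr.
  by move: h; rewrite ler_pdivrMr// mulrC.
- exact: cvg_cst.
- rewrite -[X in _ --> X](mulr0 (m.+1`!%:R)); apply: cvgMr.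
  exact: cvg_harmonic.
Unshelve. all: by end_near. Qed.

(** The segments avoid 0, so every power is derivable on them. Starting at 2 keeps the endpoints
    distinct, as integration by parts requires. *)
Lemma bigcup_segment_itvoy :
  \bigcup_n [set` `[n.+2%:R^-1, n.+2%:R]] = [set` `]0, +oo[] :> set R.
Proof.
apply/seteqP; split=> [y [n _]|y] /=.
  rewrite !in_itv/= andbT => /andP[+ _]; apply: lt_le_trans.
  by rewrite invr_gt0.
rewrite in_itv/= andbT => y0.
exists (maxn (Num.bound y) (Num.bound y^-1)) => //=.
rewrite in_itv/=; apply/andP; split.
  rewrite -[leRHS]invrK lef_pV2 ?posrE ?invr_gt0//.
  apply: le_trans (ltW (archi_boundP _)) _; first by rewrite invr_ge0 ltW.
  by rewrite ler_nat -addn2 (leq_trans _ (leq_addr _ _))// leq_maxr.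
apply: le_trans (ltW (archi_boundP _)) _; first by rewrite ltW.
by rewrite ler_nat -addn2 (leq_trans _ (leq_addr _ _))// leq_maxl.
Qed.

Lemma euler_integral_cvg x :
  (\int[mu]_(u in `[(n.+2%:R^-1)%R, n.+2%:R%R]) (euler_integrand x u)%:E)%E
    @[n --> \oo] --> euler_integral x.
Proof.
rewrite /euler_integral -bigcup_segment_itvoy.
apply: ge0_nondecreasing_set_cvg_integral.
- apply/nondecreasing_seqP => n; rewrite subsetEset.
  apply: subset_itv; rewrite bnd_simp ?ler_nat//.
  by rewrite lef_pV2 ?posrE// ler_nat.
- by move=> n; exact: measurable_itv.
- by move=> n; apply/measurable_EFinP; exact: measurable_euler_integrand.
- by move=> n u _; rewrite lee_fin euler_integrand_ge0.
Qed.

Lemma euler_integral_ge0 x : (0 <= euler_integral x)%E.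
Proof.
by apply: integral_ge0 => u _; rewrite lee_fin euler_integrand_ge0.
Qed.

(** Integration by parts with the antiderivative [- expR (- u)] of [expR (- u)]. The boundary terms
    stay explicit; for [0 < x] they vanish in the limit. *)
Lemma integral_euler_integrandS x a b : 0 < a -> a < b ->
  (\int[mu]_(u in `[a, b]) (euler_integrand (x + 1) u)%:E =
   (a `^ x * expR (- a) - b `^ x * expR (- b))%:E +
   x%:E * \int[mu]_(u in `[a, b]) (euler_integrand x u)%:E)%E.
Proof.
move=> a0 ab.
have gt0 u : u \in `[a, b] -> 0 < u.
  by rewrite in_itv/= => /andP[au _]; exact: lt_le_trans au.
have dP (c : R) : {in `[a, b], forall u, derivable (@powR R ^~ c) u 1}.
  by move=> u /gt0 u0; apply: derivable_powR; rewrite in_itv/= u0.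
have dE : forall u : R, is_derive u 1 (fun u : R => - expR (- u)) (expR (- u)).
  move=> u; apply: is_derive_eq => /=.
  by rewrite mulrN1 opprK.
have cG : {within `[a, b], continuous (fun u : R => - expR (- u))}.
  by apply: derivable_within_continuous => u _; exact: ex_derive.
have cF : {within `[a, b], continuous (@powR R ^~ x)}.
  exact: derivable_within_continuous.
have byparts := @integration_by_parts R (@powR R ^~ x) (fun u => - expR (- u))
  (fun u => x * u `^ (x - 1)) (fun u => expR (- u)) a b ab _ _ _ _ _ _.
under eq_integral do rewrite /euler_integrand addrK.
rewrite byparts.
- have -> : (\int[mu]_(u in `[a, b]) (x * u `^ (x - 1) * - expR (- u))%:E =
      (- x)%:E * \int[mu]_(u in `[a, b]) (euler_integrand x u)%:E)%E.
    rewrite -integralZl//.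
      by apply: eq_integral => u _; rewrite -EFinM /euler_integrand; congr EFin; ring.
    apply: continuous_compact_integrable; first exact: segment_compact.
    apply: derivable_within_continuous => u uab.
    by apply: derivableM; [exact: dP|exact: ex_derive].
  rewrite EFinN mulNe oppeK; congr (_ + _)%E.
  by congr EFin; ring.
- apply: derivable_within_continuous => u uab.
  by apply: derivableM => //; exact: dP.
- have /continuous_within_itvP[] := cF => // _ Fa Fb.
  by split => // u /subset_itv_oo_cc; exact: dP.
- move=> u /subset_itv_oo_cc /gt0 u0.
  by apply: powR_derive1; rewrite in_itv/= u0.
- by apply: derivable_within_continuous => u _; exact: ex_derive.
- have /continuous_within_itvP[] := cG => // _ Fa Fb.
  by split => // u _; exact: ex_derive.
- by move=> u _; rewrite derive1E derive_val.
Qed.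

End euler_integral.

(** * Gamma: functional equation, finiteness, positivity, growth over short steps *)

Section euler_integral_theory.
Context {R : realType}.
Notation mu := (@lebesgue_measure R).
Implicit Types (x a b : R).

(** The limit of the identity on segments. It is stated in the extended reals, before finiteness is
    known, because finiteness is deduced from it. *)
Lemma euler_integralS x : 0 < x ->
  euler_integral (x + 1) = (x%:E * euler_integral x)%E.
Proof.
move=> x0; apply: (cvg_unique _ (@euler_integral_cvg R (x + 1))).
  exact: ereal_hausdorff.
have -> : (fun n : nat => (\int[mu]_(u in `[(n.+2%:R^-1)%R, n.+2%:R%R])
      (euler_integrand (x + 1) u)%:E)%E) = (fun n =>
    (n.+2%:R^-1 `^ x * expR (- n.+2%:R^-1) -
     n.+2%:R `^ x * expR (- n.+2%:R))%:E + x%:E *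
     \int[mu]_(u in `[(n.+2%:R^-1)%R, n.+2%:R%R]) (euler_integrand x u)%:E)%E.
  apply/funext => n; rewrite integral_euler_integrandS ?invr_gt0//.
  by rewrite (@lt_trans _ _ 1)// ?invf_lt1// ltr1n.
rewrite -[(x%:E * euler_integral x)%E]add0e; apply: cvgeD.
- by rewrite fin_num_adde_defr.
- apply: cvg_EFin; first exact: nearW.
  rewrite -[X in _ --> X](subr0 (0 : R)); apply: cvgB.
    apply: (@squeeze_cvgr _ _ _ _ (fun=> 0) (fun n => n.+2%:R^-1 `^ x)).
    + near=> n; rewrite mulr_ge0 ?powR_ge0 ?expR_ge0//=.
      by rewrite ler_piMr ?powR_ge0// expR_le1 oppr_le0.
    + exact: cvg_cst.
    + have /cvg_at_rightP := @powR_cvg0 R x x0; apply.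
      split; first by move=> n; rewrite invr_gt0.
      by have := @cvg_harmonic R; rewrite -(cvg_shiftS (@harmonic R)).
  by have := @powR_mulexpN_cvg0 R x; rewrite -cvg_shiftS.
- by apply: cvgeZl => //; exact: euler_integral_cvg.
Unshelve. all: by end_near. Qed.

(** The integrand is [expR (- u)]; closing the interval at 0 makes the fundamental theorem of
    calculus on a half-line applicable. *)
Lemma euler_integral1_lty : (@euler_integral R 1 < +oo)%E.
Proof.
apply: (@le_lt_trans _ _ (\int[mu]_(u in `[0%R, +oo[) (expR (- u))%:E)%E).
  rewrite /euler_integral; under eq_integral.
    by move=> u _; rewrite /euler_integrand subrr powRr0 mul1r; over.
  apply: ge0_subset_integral => //=.
  - by apply/measurable_EFinP; apply: measurable_funTS; apply: measurableT_comp.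
  - by apply: subset_itv; rewrite bnd_simp.
have dE : forall u : R, is_derive u 1 (fun u : R => - expR (- u)) (expR (- u)).
  by move=> u; apply: is_derive_eq => /=; rewrite mulrN1 opprK.
have cN : continuous (fun u : R => - expR (- u)).
  by move=> u; apply/differentiable_continuous/derivable1_diffP; exact: ex_derive.
rewrite (@ge0_continuous_FTC2y R _ (fun u => - expR (- u)) 0 0) ?ltry//.
- apply: continuous_subspaceT => u.
  apply: (@continuous_comp _ _ _ -%R expR); last exact: continuous_expR.
  exact: opp_continuous.
- by rewrite -[X in _ --> X]oppr0; apply: cvgN; exact: cvgr_expR.
- exact: cvg_at_right_filter (cN 0).
- by move=> u _; rewrite derive1E derive_val.
Qed.

Lemma euler_integralSn_lty n : (@euler_integral R n.+1%:R < +oo)%E.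
Proof.
elim: n => [|n IHn]; first exact: euler_integral1_lty.
rewrite -natr1 euler_integralS ?ltr0n//.
by rewrite lte_mul_pinfty.
Qed.

(** For x between two consecutive positive integers, the integrand is at most the sum of the
    integrands at these integers: the smaller exponent dominates for u < 1, the larger one for u >=
    1. *)
Lemma euler_integral_lty x : 0 < x -> (euler_integral x < +oo)%E.
Proof.
(* If x times the integral at [x] is finite and x > 0, so is the integral; hence [x + 1] may replace
   [x]. *)
move=> x0; wlog x1 : x x0 / 1 <= x.
  move=> H; have := H (x + 1); rewrite euler_integralS//.
  rewrite addr_gt0// lerDr ltW// => /(_ isT isT).
  have := euler_integral_ge0 x.
  case: (euler_integral x) => [r|_|]; rewrite ?ltry//.
  by rewrite gt0_muley.
have [n /andP[nx xn]] : exists n, n.+1%:R <= x <= n.+2%:R.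
  exists (Num.truncn x).-1.
  have := truncn_itv (ltW x0).
  have t1 : (0 < Num.truncn x)%N by rewrite truncn_gt0.
  by rewrite prednK// => /andP[-> /ltW ->].
apply: (@le_lt_trans _ _ (euler_integral n.+1%:R + euler_integral n.+2%:R)%E).
  rewrite /euler_integral -ge0_integralD//; last 4 first.
  - by move=> u _; rewrite lee_fin euler_integrand_ge0.
  - by apply/measurable_EFinP; exact: measurable_euler_integrand.
  - by move=> u _; rewrite lee_fin euler_integrand_ge0.
  - by apply/measurable_EFinP; exact: measurable_euler_integrand.
  apply: ge0_le_integral => //.
  - by move=> u _; rewrite lee_fin euler_integrand_ge0.
  - by apply/measurable_EFinP; exact: measurable_euler_integrand.
  - apply/measurable_EFinP; apply: measurable_realfun.measurable_funD;
      exact: measurable_euler_integrand.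
  - move=> u /=; rewrite in_itv/= andbT => u0.
    rewrite -EFinD lee_fin /euler_integrand -mulrDl ler_pM2r ?expR_gt0//.
    have [u1|u1] := leP 1 u.
      rewrite (@le_trans _ _ (u `^ (n.+2%:R - 1)))//.
        by rewrite ler_powR// lerD2r.
      by rewrite lerDr powR_ge0.
    rewrite (@le_trans _ _ (u `^ (n.+1%:R - 1)))//.
      by rewrite ger_powR ?lerD2r ?u0 ?(ltW u1).
    by rewrite lerDl powR_ge0.
by rewrite lte_add_pinfty// euler_integralSn_lty.
Qed.

Lemma integrable_euler_integrand x : 0 < x ->
  mu.-integrable `]0, +oo[ (EFin \o euler_integrand x).
Proof.
move=> x0; apply/integrableP; split.
  by apply/measurable_EFinP; exact: measurable_euler_integrand.
rewrite (_ : (\int[mu]_(u in `]0%R, +oo[) _)%E = euler_integral x).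
  exact: euler_integral_lty.
by apply: eq_integral => u _ /=; rewrite ger0_norm// euler_integrand_ge0.
Qed.

Lemma euler_integralE x : 0 < x -> euler_integral x = (Gamma x)%:E.
Proof.
move=> x0; rewrite [RHS]fineK// ge0_fin_numE; last exact: euler_integral_ge0.
exact: euler_integral_lty.
Qed.

Lemma GammaS x : 0 < x -> Gamma (x + 1) = x * Gamma x.
Proof.
move=> x0; apply: EFin_inj.
by rewrite EFinM -!euler_integralE// ?addr_gt0// euler_integralS.
Qed.

(** On [1, 2] the integrand is at least [2^-1 * expR (- 2)], because [x - 1 > -1] gives u^(x-1) >=
    1/u >= 1/2. *)
Lemma Gamma_gt0 x : 0 < x -> 0 < Gamma x.
Proof.
move=> x0; rewrite -lte_fin -euler_integralE//.
apply: (@lt_le_trans _ _ (\int[mu]_(u in `[1%R, 2%R]) (2^-1 * expR (- 2))%:E)%E).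
  rewrite integral_cst//= lebesgue_measure_itv/= lte_fin ltr1n -EFinM lte_fin.
  by rewrite !mulr_gt0 ?expR_gt0// subr_gt0 ltr1n.
apply: (@le_trans _ _ (\int[mu]_(u in `[1%R, 2%R]) (euler_integrand x u)%:E)%E).
  apply: ge0_le_integral => //.
  - by apply/measurable_EFinP; exact: measurable_euler_integrand.
  - move=> u /=; rewrite in_itv/= => /andP[u1 u2].
    rewrite lee_fin ler_pM// ?expR_ge0//; last by rewrite ler_expR lerN2.
    rewrite (@le_trans _ _ (u `^ (-1)))//.
      rewrite powR_inv1 ?(le_trans _ u1)//.
      by rewrite lef_pV2// posrE ?ltr0n// (lt_le_trans ltr01 u1).
    by rewrite ler_powR// -[leLHS]add0r lerD2r ltW.
apply: ge0_subset_integral => //=.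
- by apply/measurable_EFinP; exact: measurable_euler_integrand.
- by move=> u _; rewrite lee_fin euler_integrand_ge0.
- by move=> u /=; rewrite !in_itv/= andbT => /andP[+ _]; exact: lt_le_trans.
Qed.

Lemma ler_lnB1 (y : R) : 0 < y -> ln y <= y - 1.
Proof.
move=> y0; have := @le_ln1Dx R (y - 1); rewrite (addrC 1) subrK; apply.
by rewrite ltrBrDr addNr.
Qed.

(** Weighted arithmetic-geometric inequality for 1 and [v]. With [m] the weighted mean, ln y <= y -
    1 is taken at [v / m] and [m^-1] with weights [h] and [1 - h]; the right-hand sides add up to
    0. *)
Lemma powR_le_tangent1 (v h : R) : 0 < v -> 0 <= h <= 1 ->
  v `^ h <= 1 - h + h * v.
Proof.
move=> v0 /andP[h0 h1].
have m0 : 0 < 1 - h + h * v.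
  have [->|hn0] := eqVneq h 0; first by rewrite subr0 mul0r addr0.
  by rewrite ltr_wpDl ?subr_ge0// mulr_gt0// lt_neqAle eq_sym hn0.
set m := 1 - h + h * v in m0 *.
rewrite -ler_ln ?posrE ?powR_gt0// ln_powR.
have := @ler_lnB1 (v / m); have := @ler_lnB1 m^-1.
rewrite divr_gt0// invr_gt0 m0 ln_div ?posrE// lnV ?posrE// => /(_ isT) l1 /(_ isT) l2.
have : h * (ln v - ln m) + (1 - h) * (- ln m) <=
    h * (v / m - 1) + (1 - h) * (m^-1 - 1).
  by rewrite lerD// ler_wpM2l// subr_ge0.
rewrite (_ : _ * _ + _ = h * ln v - ln m); last by ring.
rewrite [leRHS](_ : _ = m / m - 1); last by rewrite /m; ring.
by rewrite divff ?gt_eqF// subrr subr_le0.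
Qed.

(* Bernoulli: u^h <= x^h (1 + h (u/x - 1)), integrated against u^(x-1) e^(-u);
   the linear term vanishes since Gamma (x + 1) = x Gamma x. *)
Lemma le_GammaD x h : 0 < x -> 0 <= h <= 1 ->
  Gamma (x + h) <= x `^ h * Gamma x.
Proof.
move=> x0 /andP[h0 h1].
have xh0 : 0 < x + h by rewrite ltr_wpDr.
have x10 : 0 < x + 1 by rewrite addr_gt0.
have -> : x `^ h * Gamma x = x `^ h * (1 - h) * Gamma x +
                             x `^ h * (h / x) * Gamma (x + 1).
  by rewrite GammaS//; field; exact: lt0r_neq0.
have I1 : mu.-integrable `]0, +oo[
    (EFin \o (fun u => x `^ h * (1 - h) * euler_integrand x u)).
  exact: (@integrableZl _ _ _ mu _ _ _ _ (integrable_euler_integrand x0)).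
have I2 : mu.-integrable `]0, +oo[
    (EFin \o (fun u => x `^ h * (h / x) * euler_integrand (x + 1) u)).
  exact: (@integrableZl _ _ _ mu _ _ _ _ (integrable_euler_integrand x10)).
rewrite /Gamma -[X in _ <= X + _]RintegralZl//; last exact: integrable_euler_integrand.
rewrite -[X in _ <= _ + X]RintegralZl//; last exact: integrable_euler_integrand.
rewrite -RintegralD//.
apply: le_Rintegral => //.
- exact: integrable_euler_integrand.
- exact: (integrableD _ I1 I2).
move=> u /=; rewrite in_itv/= andbT /euler_integrand => u0.
have u_neq0 : u != 0 by exact: lt0r_neq0.
rewrite (_ : x + h - 1 = (x - 1) + h); last by ring.
rewrite (_ : x + 1 - 1 = (x - 1) + 1); last by ring.
rewrite (@powRD _ u (x - 1)) ?u_neq0 ?implybT//.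
rewrite (@powRD _ u (x - 1) 1) ?u_neq0 ?implybT// powRr1 ?(ltW u0)//.
have key : u `^ h <= x `^ h * (1 - h + h / x * u).
  have := @powR_le_tangent1 (u / x) h; rewrite divr_gt0// h0 h1 => /(_ isT isT).
  rewrite -(ler_pM2l (powR_gt0 h x0)) -powRM ?divr_ge0 ?(ltW x0) ?(ltW u0)//.
  by rewrite (mulrC x) divfK ?gt_eqF// (mulrCA h) (mulrC u).
rewrite [leRHS](_ : _ =
  u `^ (x - 1) * (x `^ h * (1 - h + h / x * u)) * expR (- u)); last by ring.
by rewrite ler_pM2r ?expR_gt0// ler_pM2l ?powR_gt0.
Qed.

End euler_integral_theory.

(** * Derivability from a functional equation and a growth bound *)

Section bohr_mollerup.
Context {R : realType}.
Implicit Types (x y h : R).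

(** The sign of [h] is free: [h = 1] and [h = - 1] later give the two comparisons of 1 / y with
    increments of [ln]. *)
Lemma lnD_le x h : 0 < x -> 0 < x + h -> ln (x + h) - ln x <= h / x.
Proof.
move=> x0 xh0; rewrite -ln_div ?posrE// (le_trans (ler_lnB1 _)) ?divr_gt0//.
by rewrite mulrDl divff ?gt_eqF// addrAC subrr add0r.
Qed.

Lemma is_derive1P (f : R -> R) (a l : R) :
  is_derive a 1 f l <-> h^-1 * (f (h + a) - f a) @[h --> 0^'] --> l.
Proof.
have E : (fun h => h^-1 *: ((f \o shift a) (h *: 1) - f a)) =
         (fun h => h^-1 * (f (h + a) - f a)).
  by apply/funext => h /=; rewrite [h%:A]mulr1.
split=> [[]|fl]; first by rewrite /derivable /derive E => c <-.
have c : derivable f a 1 by rewrite /derivable E; exact: cvgP fl.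
by apply: DeriveDef => //; rewrite /derive E; exact: cvg_lim.
Qed.

Variable f : R -> R.
(** For a convex [f], [f_le] would follow from [fS]: the chord slope over [x, x + h] is at most that
    over [x, x + 1], which is [ln x]. *)
Hypothesis fS : forall x, 0 < x -> f (x + 1) = ln x + f x.
Hypothesis f_le : forall x h, 0 < x -> 0 <= h <= 1 ->
  f (x + h) - f x <= h * ln x.

(** Apply [f_le] to the remaining step, from [x + h] to [x + 1], and subtract from the full
    increment [ln x]. *)
Lemma bohr_mollerup_ge x h : 0 < x -> 0 <= h <= 1 ->
  h * ln x - h / x <= f (x + h) - f x.
Proof.
move=> x0 /andP[h0 h1]; have xh0 : 0 < x + h by rewrite ltr_wpDr.
have := @f_le (x + h) (1 - h) xh0.
rewrite subr_ge0 h1 gerBl h0 (_ : x + h + (1 - h) = x + 1); last by ring.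
move=> /(_ isT); rewrite fS// => A.
have B := lnD_le x0 xh0.
have C : h * ln x <= h * ln (x + h).
  by rewrite ler_wpM2l// ler_ln ?posrE// lerDl.
by move: A B C; lra.
Qed.

Let slope x h : R := h^-1 * (f (h + x) - f x).

Lemma bohr_mollerup_slope y h : 2 <= y -> h != 0 -> `|h| <= 1 ->
  ln y - 2 / (y - 1) <= slope y h <= ln y.
Proof.
rewrite /slope => y2 hn0 hle1.
have y0 : 0 < y by lra.
have y10 : 0 < y - 1 by lra.
have [h0|h0] := leP 0 h.
  rewrite (ger0_norm h0) in hle1.
  have {}h0 : 0 < h by rewrite lt_neqAle eq_sym hn0.
  have h01 : 0 <= h <= 1 by rewrite ltW.
  rewrite (addrC h) (mulrC h^-1) ler_pdivlMr// ler_pdivrMr//.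
  apply/andP; split; last by rewrite mulrC f_le.
  apply: le_trans (bohr_mollerup_ge y0 h01); rewrite -mulrBr mulrC ler_pM2l//.
  have : y^-1 <= (y - 1)^-1 by rewrite lef_pV2// ?posrE//; lra.
  have : 0 < (y - 1)^-1 by rewrite invr_gt0.
  lra.
(* For negative [h] the estimates are taken at [h + y] with step [- h]. Their error 1 / (h + y) and
   the replacement of [ln (h + y)] by [ln y] each cost at most 1 / (y - 1), hence the constant 2. *)
rewrite (ltr0_norm h0) in hle1.
have k0 : 0 < - h by rewrite oppr_gt0.
have h01 : 0 <= - h <= 1 by rewrite ltW.
have yh0 : 0 < h + y by lra.
have := @f_le (h + y) (- h) yh0 h01.
have := @bohr_mollerup_ge (h + y) (- h) yh0 h01.
rewrite (_ : h + y - h = y); last by ring.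
rewrite -(opprB (f y)) mulrN -mulNr -invrN (mulrC (- h)^-1).
rewrite ler_pdivlMr// ler_pdivrMr//.
have hy : (h + y)^-1 <= (y - 1)^-1 by rewrite lef_pV2// ?posrE//; lra.
have lnle : ln y - ln (h + y) <= (y - 1)^-1.
  have := @lnD_le (h + y) (- h) yh0; rewrite (_ : h + y - h = y); last by ring.
  move=> /(_ y0) /le_trans; apply.
  by rewrite (le_trans _ hy)// ler_piMl// invr_ge0 ltW.
have lnge : ln (h + y) <= ln y by rewrite ler_ln ?posrE//; lra.
move=> A B.
apply/andP; split.
  apply: le_trans A; rewrite mulrC -mulrBr ler_pM2l//.
  have : 0 < (y - 1)^-1 by rewrite invr_gt0.
  lra.
by rewrite (le_trans B)// mulrC ler_wpM2r// ltW.
Qed.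

(** By [fS], the difference of the two slopes is a finite sum of difference quotients of [ln] at the
    points x + j. *)
Lemma bohr_mollerup_slope_shift x n : 0 < x ->
  slope (x + n%:R) h - slope x h @[h --> 0^'] -->
  \sum_(0 <= j < n) (x + j%:R)^-1.
Proof.
move=> x0; elim: n => [|n IHn].
  rewrite big_nil addr0; under eq_fun do rewrite subrr.
  exact: cvg_cst.
rewrite big_nat_recr//= addrC.
have xn0 : 0 < x + n%:R by rewrite ltr_wpDr.
have /is_derive1P lnD := is_derive1_ln xn0.
apply: cvg_trans (cvgD lnD IHn); apply: near_eq_cvg.
near=> h; rewrite fctE /slope.
(* This keeps [h + (x + n%:R)] positive, so that [fS] applies at the displaced point too. *)
have hx : `|h| < x by near: h; exact: dnbhs0_lt.
have hx0 : 0 < h + (x + n%:R).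
  have n0 : 0 <= n%:R :> R by [].
  by move: hx; rewrite ltr_norml => /andP[? _]; lra.
have -> : x + n.+1%:R = x + n%:R + 1 by rewrite -natr1 addrA.
rewrite (addrA h (x + n%:R)) !fS//.
by rewrite opprD addrACA [in RHS]mulrDr addrA.
Unshelve. all: by end_near. Qed.

(** The slopes at [x + n%:R] lie in a window of width 2 / (x + n - 1), and the shift lemma carries
    this window back to [x]. As n grows the slopes at [x] become Cauchy; passing to the limit for
    each n bounds the derivative. *)
Lemma bohr_mollerup_is_derive x : 0 < x -> exists2 l : R,
  is_derive x 1 f l &
  forall n, 2 <= x + n%:R ->
    - (2 / (x + n%:R - 1)) <=
    l + \sum_(0 <= j < n) (x + j%:R)^-1 - ln (x + n%:R) <= 0.
Proof.
move=> x0.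
pose s n : R := \sum_(0 <= j < n) (x + j%:R)^-1.
have bnd n : 2 <= x + n%:R -> \forall h \near 0^',
    ln (x + n%:R) - 2 / (x + n%:R - 1) <= slope (x + n%:R) h <= ln (x + n%:R).
  move=> xn2; near=> h; apply: bohr_mollerup_slope => //.
    by near: h; exact: withinT.
  by near: h; exact: (dnbhs0_le ltr01).
have cvgs : cvg (slope x h @[h --> 0^']).
  apply/cauchy_cvgP/cauchy_exP => e e0.
  have [n xn2 ne] : exists2 n : nat, 2 <= x + n%:R & 2 / (x + n%:R - 1) < e / 2.
    have e4 : 0 < 4 / e by rewrite divr_gt0.
    have := archi_boundP (ltW e4); set N := Num.bound _ => eN.
    have N1 : 1 <= N%:R :> R.
      by rewrite ler1n -(@ltr0n R) (lt_trans e4).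
    exists N.+1; rewrite -natr1; first lra.
    rewrite (_ : x + _ - 1 = x + N%:R); last by ring.
    rewrite ltr_pdivrMr; last lra.
    move: eN; rewrite ltr_pdivrMr// => eN.
    have ex0 : 0 < e * x by rewrite mulr_gt0.
    have -> : e / 2 * (x + N%:R) = (e * x + N%:R * e) / 2 by field.
    lra.
  (* Centre of a ball of radius [e] for the slopes at [x]: half of [e] pays for the window, half for
     the convergence of the shifted difference. *)
  exists (ln (x + n%:R) - s n).
  have e20 : 0 < e / 2 by rewrite divr_gt0.
  have /cvgrPdist_lt/(_ _ e20) near_sum := @bohr_mollerup_slope_shift x n x0.
  apply: filterS2 near_sum (bnd n xn2) => h; rewrite /ball/= -/(s n).
  move: (slope _ _) (slope _ _) (s n) (ln _) (2 / _) ne => a b c u v ve.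
  rewrite !ltr_norml => /andP[C D] /andP[A B].
  by apply/andP; split; lra.
exists (lim (slope x h @[h --> 0^'])); first exact/is_derive1P.
move=> n xn2.
have qn : slope (x + n%:R) h @[h --> 0^'] --> lim (slope x h @[h --> 0^']) + s n.
  have -> : slope (x + n%:R) = slope x + (fun h => slope (x + n%:R) h - slope x h).
    by apply/funext => h; rewrite fctE addrC subrK.
  exact: cvgD cvgs (@bohr_mollerup_slope_shift x n x0).
apply/andP; split.
  rewrite lerBrDr addrC; apply: (cvgr_to_ge qn).
  by apply: filterS (bnd n xn2) => h /andP[].
rewrite subr_le0; apply: (cvgr_to_le qn).
by apply: filterS (bnd n xn2) => h /andP[].
Unshelve. all: by end_near. Qed.

End bohr_mollerup.

(** * The logarithm of Gamma, and digamma against harmonic numbers *)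

Section log_gamma.
Context {R : realType}.
Implicit Types (x h : R).

Definition lnGamma x : R := ln (Gamma x).

Lemma lnGammaS x : 0 < x -> lnGamma (x + 1) = ln x + lnGamma x.
Proof. by move=> x0; rewrite /lnGamma GammaS// lnM// posrE Gamma_gt0. Qed.

Lemma le_lnGammaD x h : 0 < x -> 0 <= h <= 1 ->
  lnGamma (x + h) - lnGamma x <= h * ln x.
Proof.
move=> x0 h01; have xh0 : 0 < x + h by rewrite ltr_wpDr//; case/andP: h01.
rewrite lerBlDr -ln_powR -lnM ?posrE ?Gamma_gt0 ?powR_gt0//.
by rewrite ler_ln ?le_GammaD// posrE ?mulr_gt0 ?Gamma_gt0 ?powR_gt0.
Qed.

End log_gamma.

Section digamma_harmonic.
Context {R : realType}.
Implicit Types (x t : R).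

(** Near [x], Gamma is positive and equals [expR] of [lnGamma], so its derivative comes from the
    chain rule. *)
Lemma digammaE x l : 0 < x -> is_derive x 1 lnGamma l -> digamma x = l.
Proof.
move=> x0 dl.
have dE : is_derive x 1 (expR \o @lnGamma R) (l * Gamma x).
  have -> : l * Gamma x = expR (lnGamma x) * l.
    by rewrite lnK ?posrE ?Gamma_gt0// mulrC.
  exact: is_derive1_comp.
rewrite /digamma derive1E (@near_eq_derive _ _ _ _ (expR \o @lnGamma R))//.
  by rewrite derive_val mulfK// gt_eqF// Gamma_gt0.
near=> y; rewrite /= lnK// posrE Gamma_gt0//.
by near: y; exact: lt_nbhsr.
Unshelve. all: by end_near. Qed.

Lemma gen_harmonic1E n t : 0 <= t ->
  gen_harmonic 1 n t = \sum_(1 <= j < n.+1) (j%:R + t)^-1.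
Proof.
by move=> t0; apply: eq_bigr => j _; rewrite powRr1// addr_ge0.
Qed.

(** The bound at [t] with [n.+1] terms: the term j = 0 is [t^-1], the others form H_n(t). The
    condition [1 <= t] ensures [2 <= t + n.+1%:R]. *)
Lemma digamma_harmonic n t : 1 <= t ->
  - (2 / (t + n%:R)) <=
  digamma t + t^-1 + gen_harmonic 1 n t - ln (t + n.+1%:R) <= 0.
Proof.
move=> t1; have t0 : 0 < t by exact: lt_le_trans t1.
have [l dl] := bohr_mollerup_is_derive (@lnGammaS R) (@le_lnGammaD R) t0.
rewrite (digammaE t0 dl) => /(_ n.+1).
have n0 : 0 <= n%:R :> R by [].
rewrite big_nat_recl// addr0 (addrA l) gen_harmonic1E ?(ltW t0)// big_add1/=.
rewrite (_ : t + n.+1%:R - 1 = t + n%:R); last by rewrite -natr1; ring.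
rewrite (eq_bigr (fun j => (j.+1%:R + t)^-1)); last first.
  by move=> j _; rewrite addrC.
by apply; rewrite -natr1; lra.
Qed.

End digamma_harmonic.

(** * Independence of choices made at different times *)

Section independence.
Context d (T : measurableType d) (R : realType) (P : probability T R).

Lemma probability_bigcup_finType (I : finType) (F : I -> set T) :
  (forall i, measurable (F i)) -> trivIset setT F ->
  P (\bigcup_i F i) = (\sum_i P (F i))%E.
Proof.
move=> mF tF; rewrite measure_fin_bigcup//; last exact: finite_finset.
rewrite [RHS]bigfs ?index_enum_uniq//; last by move=> i; rewrite mem_index_enum.
by congr (\big[_/_]_(i \in _) _); apply/seteqP; split.
Qed.

Variables (theta : nat) (S : T -> forall m, {set 'I_(m + theta)}).
Hypothesis treeS : hyperrecursive_tree P S.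

(** The factor [[set _ | Q A]] is everything or empty; it lets the union range over a whole finite
    type. *)
Lemma choice_bigcup m (X : set T) (Q : pred {set 'I_(m + theta)}) :
  X `&` [set w | Q (S w m)] =
  \bigcup_A (X `&` choice_event S (m:=m) A `&` [set _ | Q A]).
Proof.
apply/seteqP; split=> [w [Xw /= Qw]|w [A _ [[Xw /= <-] QA]]]//.
by exists (S w m).
Qed.

Lemma measurable_choice_pred m (Q : pred {set 'I_(m + theta)}) :
  measurable [set w | Q (S w m)].
Proof.
rewrite -[X in measurable X]setTI choice_bigcup.
apply: fin_bigcup_measurable; first exact: finite_finset.
move=> A _; rewrite setTI.
case: (Q A); last by rewrite (_ : [set _ | _] = set0) ?setI0//; apply/seteqP; split.
rewrite (_ : [set _ | _] = setT) ?setIT; last by apply/seteqP; split.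
exact: choice_measurable treeS _ _.
Qed.

Lemma probability_choice_pred m (X : set T) (Q : pred {set 'I_(m + theta)}) :
  measurable X ->
  P (X `&` [set w | Q (S w m)]) =
  (\sum_(A | Q A) P (X `&` choice_event S (m:=m) A))%E.
Proof.
move=> mX; rewrite choice_bigcup probability_bigcup_finType.
- rewrite [RHS]big_mkcond/=; apply: eq_bigr => A _.
  case: (Q A).
    by rewrite (_ : [set _ | _] = setT) ?setIT//; apply/seteqP; split.
  by rewrite (_ : [set _ | _] = set0) ?setI0 ?measure0//; apply/seteqP; split.
- move=> A; rewrite -setIA; apply: measurableI => //.
  have := @measurable_choice_pred m (fun B => Q B && (B == A)).
  rewrite (_ : [set w | _] = choice_event S A `&` [set _ | Q A])//.
  apply/seteqP; split=> w /=; first by move=> /andP[QA /eqP <-].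
  by move=> [<- ->]/=.
- by move=> A B _ _ [w [[[_ <-] _] [[_ <-] _]]].
Qed.

(** Stands for membership in the sigma-algebra of the choices before [m]. One implication suffices,
    since [w] and [w'] can be exchanged. *)
Definition past_determined m (X : set T) :=
  forall w w', (forall i, (i < m)%N -> S w i = S w' i) -> X w -> X w'.

Lemma measurable_past_event m h : measurable (past_event S m h).
Proof.
rewrite (_ : past_event S m h = \bigcap_(i in `I_m) choice_event S (h i)).
  apply: fin_bigcap_measurable; first exact: finite_II.
  by move=> i _; exact: choice_measurable treeS _ _.
by apply/seteqP; split.
Qed.

(* Splitting over the choice made at time r turns histories of length r into
   histories of length r + 1, until the whole history up to m is fixed. *)
Lemma past_event_indep m (X : set T) r (h : forall i, {set 'I_(i + theta)})
    (A : {set 'I_(m + theta)}) :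
  past_determined m X -> (r <= m)%N ->
  measurable (X `&` past_event S r h) /\
  P (X `&` past_event S r h `&` choice_event S A) =
  (P (X `&` past_event S r h) * P (choice_event S A))%E.
Proof.
move=> pX /subnKC; move: (m - r)%N => k.
elim: k r h => [|k IHk] r h.
  rewrite addn0 => ->.
  (* Once the history up to [m] is fixed, [X] either contains the past event or misses it. *)
  have [[w [Xw hw]]|nX] := pselect (X `&` past_event S m h !=set0).
    have -> : X `&` past_event S m h = past_event S m h.
      apply/setIidPr => w' hw'; apply: pX Xw => i im.
      by rewrite hw// hw'.
    split; first exact: measurable_past_event.
    exact: choice_indep treeS _ _ _.
  have -> : X `&` past_event S m h = set0.
    by apply/seteqP; split => // w Xw; apply: nX; exists w.
  by split => //; rewrite set0I measure0 mul0e.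
rewrite addnS -addSn => rm.
(* [H B] is the history [h] with its value at time [r] overwritten by [B]. *)
pose H (B : {set 'I_(r + theta)}) : forall i, {set 'I_(i + theta)} :=
  @eqtype.dfwith nat (fun i => {set 'I_(i + theta)}) h r B.
have E : X `&` past_event S r h = \bigcup_B (X `&` past_event S r.+1 (H B)).
  apply/seteqP; split=> [w [Xw hw]|w [B _ [Xw Hw]]].
    exists (S w r) => //; split=> // i; rewrite ltnS leq_eqVlt => /predU1P[->|ir].
      by rewrite /H dfwith_in.
    by rewrite /H dfwith_out ?hw// gtn_eqF.
  split=> // i ir; rewrite Hw ?ltnS ?(ltnW ir)//.
  by rewrite /H dfwith_out// gtn_eqF.
have tE Y : trivIset setT (fun B => X `&` past_event S r.+1 (H B) `&` Y).
  move=> B C _ _ [w [[[_ Bw] _] [[_ Cw] _]]].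
  by have := Bw r (ltnSn r); rewrite (Cw r (ltnSn r)) /H !dfwith_in.
have mE B := (IHk r.+1 (H B) rm).1.
split.
  by rewrite E; apply: fin_bigcup_measurable; first exact: finite_finset.
rewrite E setI_bigcupl.
rewrite probability_bigcup_finType; last 2 first.
- by move=> B; apply: measurableI => //; exact: choice_measurable treeS _ _.
- exact: tE.
rewrite probability_bigcup_finType//; last first.
  rewrite (_ : (fun B => _) =
    (fun B => X `&` past_event S r.+1 (H B) `&` setT)); first exact: tE.
  by apply/funext => B; rewrite setIT.
rewrite ge0_sume_distrl//; apply: eq_bigr => B _.
exact: (IHk r.+1 (H B) rm).2.
Qed.

(** Split the later event by the value chosen; the earlier event is determined by the past of
    [n]. *)
Lemma choice_pred_indep m n (Q : pred {set 'I_(m + theta)})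
    (Q' : pred {set 'I_(n + theta)}) : (m < n)%N ->
  P ([set w | Q (S w m)] `&` [set w | Q' (S w n)]) =
  (P [set w | Q (S w m)] * P [set w | Q' (S w n)])%E.
Proof.
move=> mn; rewrite probability_choice_pred; last exact: measurable_choice_pred.
rewrite -[X in (_ * P X)%E]setTI probability_choice_pred//.
rewrite ge0_sume_distrr//; apply: eq_bigr => A _; rewrite setTI.
have pX : past_determined n [set w | Q (S w m)].
  by move=> w w' /(_ _ mn) /= ->.
have [_] := @past_event_indep n _ 0 (fun=> finset.set0) A pX (leq0n _).
by rewrite (_ : past_event S 0 _ = setT) ?setIT//; apply/seteqP; split.
Qed.

End independence.

(** Pascal's rule: from all sets of size [k.+1], remove those inside the complement of [v]. *)
Lemma card_draws_mem (T : finType) (v : T) k :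
  #|[set A : {set T} | (v \in A) && (#|A| == k.+1)]%SET| = 'C(#|T|.-1, k).
Proof.
have cT : #|T| = #|T|.-1.+1 by rewrite prednK//; apply/card_gt0P; exists v.
have := cards_draws [set: T]%SET k.+1; rewrite cardsT.
rewrite -(cardsID [set A : {set T} | v \in A]%SET).
rewrite (_ : _ :&: _ = [set A : {set T} | (v \in A) && (#|A| == k.+1)])%SET; last first.
  by apply/setP => A; rewrite !inE finset.subsetT andbC.
rewrite (_ : _ :\: _ = [set A : {set T} |
    A \subset [set~ v] & #|A| == k.+1])%SET; last first.
  by apply/setP => A; rewrite !inE finset.subsetT -finset.disjoints_subset
    disjoint_sym disjoints1.
rewrite cards_draws cardsC1 cT binS/= addnC => /eqP.
by rewrite eqn_add2l => /eqP.
Qed.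

(** * Deterministic recursion for the containment level *)

Section containment_level_recursion.
Variables (theta : nat) (S : forall m, {set 'I_(m + theta)}) (o : 'I_theta).

(** Vertices are compared as numbers, because the ordinal type of a given vertex changes with
    [m]. *)
Definition chosen (u m : nat) (A : {set 'I_(m + theta)}) : bool :=
  [exists v in A, val v == u].

Lemma vertex_ltn k m : (vertex o k < m + theta)%N = (k <= m)%N.
Proof.
case: k => [|k] /=; last by rewrite ltn_add2r.
by rewrite (leq_trans (ltn_ord o))// leq_addl.
Qed.

Lemma chosen_vertexN k m (A : {set 'I_(m + theta)}) :
  (m < k)%N -> chosen (vertex o k) A = false.
Proof.
move=> mk; apply/existsP => -[v /andP[_ /eqP vk]].
by have := ltn_ord v; rewrite [X in (X < _)%N]vk vertex_ltn leqNgt mk.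
Qed.

Lemma vertex_eq k m : (vertex o k == m + theta)%N = (k == m.+1)%N.
Proof.
case: k => [|k] /=; last by rewrite eqn_add2r.
by rewrite ltn_eqF// (leq_trans (ltn_ord o))// leq_addl.
Qed.

Lemma mem_hyperedgeS k m :
  [exists v in hyperedge S m.+1, val v == vertex o k] =
  (k == m.+1) || chosen (vertex o k) (S m).
Proof.
rewrite -vertex_eq; apply/existsP/orP.
  move=> [v /andP[]]; rewrite !inE => /predU1P[->/=|].
    by rewrite eq_sym; left.
  move=> /imsetP[u uS ->] /eqP; rewrite [val _]lift_max => <-.
  by right; apply/existsP; exists u; rewrite uS/=.
move=> [/eqP vE|/existsP[u /andP[uS /eqP uE]]].
  by exists ord_max; rewrite !inE eqxx/= vE.
exists (lift ord_max u); rewrite !inE imset_f ?orbT//=.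
by rewrite [X in X == _]lift_max; apply/eqP.
Qed.

Lemma containment_level_sum n k :
  containment_level S o n k =
  (\sum_(j < n.+1) [exists v in hyperedge S j, val v == vertex o k])%N.
Proof.
rewrite /containment_level -sum1_card big_mkcond; apply: eq_bigr => j _.
by case: ifPn => [/set_mem /= ->//|]; rewrite notin_setE /= => /negP/negbTE ->.
Qed.

Lemma containment_levelS n k :
  containment_level S o n.+1 k =
  (containment_level S o n k + ((k == n.+1) || chosen (vertex o k) (S n)))%N.
Proof. by rewrite !containment_level_sum big_ord_recr/= mem_hyperedgeS. Qed.

Lemma containment_level0 k : containment_level S o 0 k = (k == 0)%N.
Proof.
rewrite containment_level_sum big_ord_recr big_ord0/= add0n.
congr nat_of_bool; apply/existsP/eqP => [[v /andP[_ /eqP vE]]|->].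
  by have := ltn_ord v; rewrite [X in (X < _)%N]vE vertex_ltn leqn0 => /eqP.
by exists o; rewrite inE/=.
Qed.

Lemma containment_levelNltn n k : (n < k)%N -> containment_level S o n k = 0%N.
Proof.
elim: n => [|n IHn] nk; first by rewrite containment_level0 gtn_eqF.
by rewrite containment_levelS IHn ?(ltnW nk)// gtn_eqF// chosen_vertexN// ltnW.
Qed.

Lemma containment_leveln n : containment_level S o n n = 1%N.
Proof.
case: n => [|n]; first by rewrite containment_level0.
by rewrite containment_levelS eqxx containment_levelNltn.
Qed.

End containment_level_recursion.

(** * Exact mean and variance of the containment level *)

Lemma Lfun_indic d (T : measurableType d) (R : realType) (P : probability T R)
  (A : set T) (r : R) : measurable A -> 0 < r -> (\1_A : T -> R) \in Lfun P r%:E.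
Proof.
move=> mA r0; rewrite inE; apply/andP; split; rewrite inE/=.
  exact: measurable_indic.
rewrite /finite_norm unlock poweR_lty//.
rewrite (_ : (\int[P]_x _)%E = \int[P]_x (\1_A x)%:E)%E.
  by rewrite integral_indic// setIT (le_lt_trans (probability_le1 P mA))// ltry.
apply: eq_integral => x _ /=; rewrite indicE.
case: (x \in A) => /=; first by rewrite normr1 powR1.
by rewrite normr0 powR0 ?gt_eqF.
Qed.

Section containment_moments.
Context d (T : measurableType d) (R : realType) (P : probability T R).
Variables (theta : nat) (S : T -> forall m, {set 'I_(m + theta)}).
Hypothesis treeS : hyperrecursive_tree P S.
Variable o : 'I_theta.
Hypothesis theta_ge2 : (2 <= theta)%N.
Let t : R := theta%:R - 1.

Let chosen_event k m : set T := [set w | chosen (vertex o k) (S w m)].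

Let measurable_chosen k m : measurable (chosen_event k m).
Proof. exact: (measurable_choice_pred treeS). Qed.

(** Of the C(m + theta, theta - 1) equally likely sets, C(m + theta - 1, theta - 2) contain the
    vertex; the ratio is (theta - 1) / (m + theta). *)
Lemma probability_chosen k m : (k <= m)%N ->
  P (chosen_event k m) = (t / (m.+1%:R + t))%:E.
Proof.
move=> km; rewrite -[chosen_event k m]setTI (probability_choice_pred treeS)//.
have km' : (vertex o k < m + theta)%N by rewrite vertex_ltn.
pose v := Ordinal km'.
have theta1 : theta = (theta - 1).+1 by rewrite subn1 prednK// ltnW.
have t1 : (theta - 1 = (theta - 2).+1)%N by rewrite -subSn// subnS.
under eq_bigr do rewrite setTI (choice_uniform treeS).
rewrite sumEFin; congr EFin.
rewrite -big_mkcondr/= sumr_const.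
rewrite (_ : #|_| = 'C((m + theta).-1, theta - 2)); last first.
  rewrite -[in RHS](card_ord (m + theta)) -(card_draws_mem v) -cardsE.
  apply: eq_card => A; rewrite !inE -t1; congr (_ && _).
  apply/existsP/idP => [[u /andP[uA /eqP uv]]|vA]; last first.
    by exists v; rewrite vA/=.
  by rewrite (_ : v = u)//; apply/val_inj.
have mt0 : (0 < m + theta)%N by rewrite addn_gt0 (ltnW theta_ge2) orbT.
have C0 : 'C(m + theta, theta - 1)%:R != 0 :> R.
  by rewrite pnatr_eq0 -lt0n bin_gt0 (leq_trans (leq_subr _ _))// leq_addl.
have tE : t = (theta - 1)%:R by rewrite natrB// ltnW.
have mtE : m.+1%:R + t = (m + theta)%:R.
  by rewrite -natr1 natrD /t; ring.
rewrite mtE -[LHS]mulr_natl; apply/eqP; rewrite eqr_div//; last first.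
  by rewrite pnatr_eq0 -lt0n.
by rewrite tE -!natrM mulnC mul_bin_diag -t1.
Qed.

Lemma containmentS k n : (k <= n)%N ->
  containment R S o n.+1 k = containment R S o n k \+ \1_(chosen_event k n).
Proof.
move=> kn; apply/funext => w; rewrite /containment containment_levelS/= natrD.
congr (_ + _); rewrite ltn_eqF ?ltnS// indicE; congr (_%:R); congr nat_of_bool.
by apply/idP/idP => [/mem_set|/set_mem].
Qed.

Lemma containment_diag k : containment R S o k k = cst 1.
Proof. by apply/funext => w; rewrite /containment containment_leveln. Qed.

Lemma containment_Lfun2 n k : (k <= n)%N -> containment R S o n k \in Lfun P 2%:E.
Proof.
elim: n => [|n IHn]; first by rewrite leqn0 => /eqP ->; rewrite containment_diag Lfun_cst.
rewrite leq_eqVlt => /predU1P[->|]; first by rewrite containment_diag Lfun_cst.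
rewrite ltnS => kn; rewrite containmentS// rpredD ?lee1n//= => _.
  exact: IHn.
exact: Lfun_indic.
Qed.

(** By linearity in the first argument: the level at time [n] is 1 plus indicators of choices with
    index below [n], each independent of the choice with index [m]. *)
Lemma containment_chosen_uncorrelated k n m : (k <= n)%N -> (n <= m)%N ->
  covariance P (containment R S o n k) \1_(chosen_event k m) = 0%E.
Proof.
move=> + nm; elim: n nm => [|n IHn] nm.
  by rewrite leqn0 => /eqP ->; rewrite containment_diag covariance_cst_l.
rewrite leq_eqVlt => /predU1P[->|]; first by rewrite containment_diag covariance_cst_l.
rewrite ltnS => kn; rewrite containmentS//.
rewrite covarianceDl ?containment_Lfun2 ?Lfun_indic//.
rewrite IHn ?add0e ?(ltnW nm)//.
have L1 j : (\1_(chosen_event k j) : T -> R) \in Lfun P 1 by exact: Lfun_indic.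
have I : (\1_(chosen_event k n) * \1_(chosen_event k m) : T -> R) =
    \1_(chosen_event k n `&` chosen_event k m).
  by rewrite indicI.
rewrite covarianceE// I; last by apply: Lfun_indic => //; exact: measurableI.
rewrite !expectation_indic//; last exact: measurableI.
rewrite (choice_pred_indep treeS)// subee//.
by rewrite fin_numM// fin_num_measure//; exact: (measurable_choice_pred treeS).
Qed.

Lemma gen_harmonicS (s : R) n (x : R) :
  gen_harmonic s n.+1 x = gen_harmonic s n x + ((n.+1%:R + x) `^ s)^-1.
Proof. by rewrite /gen_harmonic big_nat_recr. Qed.

Let t_ge1 : 1 <= t.
Proof. by rewrite /t lerBrDr -[1 + 1]/(2%:R) ler_nat. Qed.

Lemma expectation_containment n k : (k <= n)%N ->
  'E_P[containment R S o n k]%E =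
  (1 + t * (gen_harmonic 1 n t - gen_harmonic 1 k t))%:E.
Proof.
elim: n => [|n IHn].
  rewrite leqn0 => /eqP ->.
  by rewrite containment_diag expectation_cst subrr mulr0 addr0.
rewrite leq_eqVlt => /predU1P[->|].
  by rewrite containment_diag expectation_cst subrr mulr0 addr0.
rewrite ltnS => kn; rewrite containmentS// expectationD; last 2 first.
  apply: Lfun_subset12; first exact: fin_num_measure.
  exact: containment_Lfun2.
  exact: Lfun_indic.
rewrite expectation_indic// probability_chosen// IHn// -EFinD; congr EFin.
have t0 : 0 <= t by exact: le_trans t_ge1.
have nt0 : 0 <= n.+1%:R + t by rewrite addr_ge0.
rewrite gen_harmonicS powRr1//.
by rewrite -addrA; congr (1 + _); rewrite [in RHS]addrAC [in RHS]mulrDr.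
Qed.

(** Each step adds a Bernoulli variance p - p^2 with p = t / (n + 1 + t), which feeds the two
    harmonic sums; the covariance vanishes. *)
Lemma variance_containment n k : (k <= n)%N ->
  'V_P[containment R S o n k]%E =
  (t * (gen_harmonic 1 n t - gen_harmonic 1 k t) -
   t ^+ 2 * (gen_harmonic 2 n t - gen_harmonic 2 k t))%:E.
Proof.
elim: n => [|n IHn].
  rewrite leqn0 => /eqP ->.
  by rewrite containment_diag variance_cst !subrr !mulr0 subrr.
rewrite leq_eqVlt => /predU1P[->|].
  by rewrite containment_diag variance_cst !subrr !mulr0 subrr.
rewrite ltnS => kn; rewrite containmentS// varianceD ?containment_Lfun2 ?Lfun_indic//.
rewrite containment_chosen_uncorrelated// mule0 adde0 IHn//.
rewrite varianceE ?Lfun_indic//.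
rewrite (_ : \1_(chosen_event k n) ^+ 2 = \1_(chosen_event k n) :> (T -> R)); last first.
  by rewrite expr2 -[in RHS](setIid (chosen_event k n)) indicI.
rewrite expectation_indic// probability_chosen//.
have t0 : 0 <= t by exact: le_trans t_ge1.
have nt0 : 0 <= n.+1%:R + t by rewrite addr_ge0.
rewrite -EFin_expe -EFinB -EFinD; congr EFin.
rewrite !gen_harmonicS powRr1// powR_mulrn// !expr2 invfM.
move: (gen_harmonic 1 n t) (gen_harmonic 1 k t) (gen_harmonic 2 n t)
  (gen_harmonic 2 k t) (n.+1%:R + t)^-1 => a b c e f.
by move: t => x; ring.
Qed.

End containment_moments.

(** * Explicit bounds for differences of harmonic numbers *)

Section harmonic_asymptotics.
Context {R : realType}.
Implicit Types t : R.

(** Telescoping of 1 / y <= ln y - ln (y - 1). *)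
Lemma harmonicB_le t k n : 0 < k%:R + t -> 0 <= t -> (k <= n)%N ->
  gen_harmonic 1 n t - gen_harmonic 1 k t <= ln (n%:R + t) - ln (k%:R + t).
Proof.
move=> kt0 t0; elim: n => [|n IHn].
  by rewrite leqn0 => /eqP ->; rewrite !subrr.
rewrite leq_eqVlt => /predU1P[->|]; first by rewrite !subrr.
rewrite ltnS => kn; have {}IHn := IHn kn.
have nt0 : 0 < n%:R + t by rewrite (lt_le_trans kt0)// lerD2r ler_nat.
have St0 : 0 < n.+1%:R + t by rewrite ltr_pwDl.
have := @lnD_le R (n.+1%:R + t) (- 1) St0.
rewrite (_ : n.+1%:R + t - 1 = n%:R + t); last by rewrite -natr1; ring.
move=> /(_ nt0); rewrite mulN1r gen_harmonicS powRr1 ?(ltW St0)//.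
by move: IHn; lra.
Qed.

(** Telescoping of ln (y + 1) - ln y <= 1 / y. *)
Lemma harmonicB_ge t k n : 0 <= t -> (k <= n)%N ->
  ln (n.+1%:R + t) - ln (k.+1%:R + t) <=
  gen_harmonic 1 n t - gen_harmonic 1 k t.
Proof.
move=> t0; elim: n => [|n IHn].
  by rewrite leqn0 => /eqP ->; rewrite !subrr.
rewrite leq_eqVlt => /predU1P[->|]; first by rewrite !subrr.
rewrite ltnS => kn; have {}IHn := IHn kn.
have St0 : 0 < n.+1%:R + t by rewrite ltr_pwDl.
have SSt0 : 0 < n.+2%:R + t by rewrite ltr_pwDl.
have := @lnD_le R (n.+1%:R + t) 1 St0.
rewrite (_ : n.+1%:R + t + 1 = n.+2%:R + t); last by rewrite -[in RHS]natr1; ring.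
move=> /(_ SSt0); rewrite mul1r gen_harmonicS powRr1 ?(ltW St0)//.
by move: IHn; lra.
Qed.

(** The excess is at most ln (n + t) - ln n <= t / k, the deficit at most ln (k + 1 + t) - ln k <=
    (t + 1) / k. *)
Lemma harmonicB_ln t k n : 0 <= t -> (0 < k)%N -> (k <= n)%N ->
  `|gen_harmonic 1 n t - gen_harmonic 1 k t - ln (n%:R / k%:R)| <= (t + 1) / k%:R.
Proof.
move=> t0 k0 kn.
have K0 : 0 < k%:R :> R by rewrite ltr0n.
have n0 : (0 < n)%N := leq_trans k0 kn.
have N0 : 0 < n%:R :> R by rewrite ltr0n.
have KN : n%:R^-1 <= k%:R^-1 :> R by rewrite lef_pV2 ?posrE// ler_nat.
have Nt0 : 0 < n%:R + t by rewrite ltr_pwDl.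
have Kt0 : 0 < k%:R + t by rewrite ltr_pwDl.
have St0 : 0 < k.+1%:R + t by rewrite ltr_pwDl.
have nt0 : 0 < n.+1%:R + t by rewrite ltr_pwDl.
have A := harmonicB_le Kt0 t0 kn; have B := harmonicB_ge t0 kn.
have C := lnD_le N0 Nt0.
have D : ln k%:R <= ln (k%:R + t) by rewrite ler_ln ?posrE// lerDl.
have E := @lnD_le R k%:R (1 + t) K0.
have F : ln n%:R <= ln (n.+1%:R + t).
  by rewrite ler_ln ?posrE//; rewrite -natr1; lra.
have G : t / n%:R <= t / k%:R by rewrite ler_wpM2l.
have H : 0 < k%:R^-1 :> R by rewrite invr_gt0.
rewrite addrA natr1 in E; have {}E := E St0.
rewrite ln_div ?posrE//.
rewrite ler_norml; apply/andP; split; lra.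
Qed.

(** Telescoping of 1 / y^2 <= 1 / (y - 1) - 1 / y. *)
Lemma gen_harmonic2B_bound t k n : 1 <= t -> (k <= n)%N ->
  0 <= gen_harmonic 2 n t - gen_harmonic 2 k t <= (k%:R + t)^-1 - (n%:R + t)^-1.
Proof.
move=> t1; elim: n => [|n IHn].
  by rewrite leqn0 => /eqP ->; rewrite !subrr lexx.
rewrite leq_eqVlt => /predU1P[->|]; first by rewrite !subrr lexx.
rewrite ltnS => kn; have /andP[A B] := IHn kn.
have t0 : 0 < t by exact: lt_le_trans t1.
have nt0 : 0 < n%:R + t by rewrite ltr_wpDl.
have nt1 : 0 < n.+1%:R + t by rewrite ltr_wpDl.
rewrite gen_harmonicS powR_mulrn ?(ltW nt1)//.
have C : 0 < ((n.+1%:R + t) ^+ 2)^-1 by rewrite invr_gt0 exprn_gt0.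
have D : ((n.+1%:R + t) ^+ 2)^-1 <= (n%:R + t)^-1 - (n.+1%:R + t)^-1.
  have -> : (n%:R + t)^-1 - (n.+1%:R + t)^-1 = ((n%:R + t) * (n.+1%:R + t))^-1.
    rewrite -natr1 in nt1 *.
    by field; rewrite !gt_eqF.
  rewrite lef_pV2 ?posrE ?mulr_gt0 ?exprn_gt0// expr2 ler_pM2r// lerD2r.
  by rewrite ler_nat.
apply/andP; split; lra.
Qed.

End harmonic_asymptotics.

(** * From explicit bounds to the asymptotic statements *)

Lemma eqaddO_bound (R : realType) (T : Type) (F : filter_on T) (f g e : T -> R) (C : R) :
  0 < C -> (\forall x \near F, `|f x - g x| <= C * `|e x|) -> f = g +O_F e.
Proof.
by move=> C0 fge; apply/eqaddOP/bigO_exP; exists C.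
Qed.

Theorem proposition4p1 (R : realType) (d : measure_display)
    (T : measurableType d) (P : probability T R) (theta : nat)
    (S : T -> forall m, {set 'I_(m + theta)}) (o : 'I_theta) :
  (2 <= theta)%N -> hyperrecursive_tree P S ->
  let t : R := theta%:R - 1 in
  let H (n : nat) (x : R) := gen_harmonic 1 n x in
  let H2 (n : nat) (x : R) := gen_harmonic 2 n x in
  let E (n k : nat) : \bar R := 'E_P[containment R S o n k]%E in
  let V (n k : nat) : \bar R := 'V_P[containment R S o n k]%E in
  [/\ (forall n k : nat, (k <= n)%N ->
        E n k = (1 + t * (H n t - H k t))%:E /\
        V n k = (t * (H n t - H k t) - t ^+ 2 * (H2 n t - H2 k t))%:E),
      (forall k : nat,
        (fun n => fine (E n k)) =
          (fun n => t * (ln n%:R - digamma t - t^-1) + 1 - t * H k t)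
            +O_\oo (fun n => n%:R^-1 : R) /\
        (fun n => fine (V n k)) =
          (fun n => t * ln n%:R) +O_\oo (fun=> 1 : R)) &
      (fun p => fine (E p.1 p.2)) =
        (fun p => t * ln (p.1%:R / p.2%:R) + 1)
          +O_n_ge_k_oo (fun p => p.2%:R^-1 : R) /\
      (fun p => fine (V p.1 p.2)) =
        (fun p => t * ln (p.1%:R / p.2%:R))
          +O_n_ge_k_oo (fun p => p.2%:R^-1 : R) ].
Proof.
move=> theta2 treeS t H H2 E V.
have EE n k : (k <= n)%N -> E n k = (1 + t * (H n t - H k t))%:E.
  exact: expectation_containment.
have VE n k : (k <= n)%N ->
    V n k = (t * (H n t - H k t) - t ^+ 2 * (H2 n t - H2 k t))%:E.
  exact: variance_containment.
have t1 : 1 <= t by rewrite /t lerBrDr -[1 + 1]/(2%:R) ler_nat.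
have t0 : 0 < t by exact: lt_le_trans t1.
clearbody t E V.
(* In the regime [k --> oo] the bounds hold for all 1 <= k <= n, with constants depending on [t]
   only. *)
have nearD (Q : nat * nat -> Prop) :
    (forall n k, (0 < k)%N -> (k <= n)%N -> Q (n, k)) ->
    \forall p \near n_ge_k_oo, Q p.
  move=> HQ; exists (setT, [set k | (0 < k)%N]) => /=.
    by split; [exact: filterT|exact: nbhs_infty_gt].
  by move=> [n k] [_ /= k0] kn; exact: HQ.
split.
- by move=> n k kn; rewrite EE// VE.
- move=> k; split.
    (* Here 2 / n comes from [digamma_harmonic], and (1 + t) / n from replacing ln (n + 1 + t) by ln
       n. *)
    apply: (@eqaddO_bound _ _ _ _ _ _ (t * (t + 3))).
      by rewrite mulr_gt0// addr_gt0.
    near=> n.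
    have n0 : (0 < n)%N by near: n; exact: nbhs_infty_gt.
    have kn : (k <= n)%N by near: n; exact: nbhs_infty_ge.
    have N0 : 0 < n%:R :> R by rewrite ltr0n.
    rewrite EE//= (@ger0_norm _ n%:R^-1) ?invr_ge0 ?(ltW N0)//.
    have -> : 1 + t * (H n t - H k t) -
        (t * (ln n%:R - digamma t - t^-1) + 1 - t * H k t) =
        t * (digamma t + t^-1 + H n t - ln n%:R) by ring.
    rewrite normrM gtr0_norm// -mulrA ler_pM2l//.
    have nt0 : 0 < n%:R + (1 + t) by rewrite addr_gt0// addr_gt0.
    have := digamma_harmonic n t1; rewrite -/(H n t).
    rewrite (_ : t + n.+1%:R = n%:R + (1 + t)); last by rewrite -natr1; ring.
    have A := lnD_le N0 nt0.
    have B : ln n%:R <= ln (n%:R + (1 + t)) by rewrite ler_ln ?posrE// lerDl; lra.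
    have C : (t + n%:R)^-1 <= n%:R^-1.
      by rewrite lef_pV2 ?posrE ?addr_gt0// lerDr ltW.
    have D : 0 < n%:R^-1 :> R by rewrite invr_gt0.
    have F : 0 < t * n%:R^-1 by rewrite mulr_gt0.
    move: A B C D F.
    move: (digamma t) (t^-1) (H n t) (ln (n%:R + (1 + t))) (ln n%:R) (n%:R^-1)
      ((t + n%:R)^-1) => a b c e f g h A B C D F /andP[I J].
    rewrite ler_norml; apply/andP; split; lra.
  apply: (@eqaddO_bound _ _ _ _ _ _
      (t * ((t + 1) + `|H 1%N t| + `|H k t|) + t ^+ 2)).
    by rewrite ltr_wpDl ?exprn_gt0// mulr_ge0 ?(ltW t0)// !addr_ge0// ltW.
  near=> n.
  have n0 : (0 < n)%N by near: n; exact: nbhs_infty_gt.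
  have kn : (k <= n)%N by near: n; exact: nbhs_infty_ge.
  rewrite VE//= normr1 mulr1.
  (* The comparison starts from index 1, since [k] may be 0; the correction by [H 1 t] and [H k t]
     is a constant. *)
  have := harmonicB_ln (ltW t0) (ltnSn 0) n0; rewrite divr1 -/(H _ _) => A.
  have /andP[B C] := gen_harmonic2B_bound t1 kn.
  have D : H2 n t - H2 k t <= 1.
    rewrite (le_trans C)// (@le_trans _ _ (k%:R + t)^-1)//.
      by rewrite gerBl invr_ge0 addr_ge0// ltW.
    by rewrite invf_le1 ?ltr_wpDl// (le_trans t1)// lerDr.
  rewrite (_ : _ - _ - _ = t * ((H n t - H 1%N t - ln n%:R) + H 1%N t - H k t)
    - t ^+ 2 * (H2 n t - H2 k t)); last by ring.
  rewrite (le_trans (ler_normB _ _))// lerD//.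
    rewrite normrM gtr0_norm// ler_pM2l// (le_trans (ler_normB _ _))// lerD//.
    by rewrite (le_trans (ler_normD _ _))// lerD//; move: A; rewrite divr1.
  by rewrite ger0_norm ?mulr_ge0 ?exprn_ge0 ?(ltW t0)// ler_piMr ?exprn_ge0 ?(ltW t0).
- split.
    apply: (@eqaddO_bound _ _ _ _ _ _ (t * (t + 1))); first by rewrite mulr_gt0 ?addr_gt0.
    apply: nearD => n k k0 kn.
    rewrite EE//= (@ger0_norm _ k%:R^-1) ?invr_ge0//.
    rewrite (_ : _ - _ = t * (H n t - H k t - ln (n%:R / k%:R))); last by ring.
    by rewrite normrM gtr0_norm// -mulrA ler_pM2l// harmonicB_ln// ltW.
  (* The first summand is the error of the mean; the second bounds the second-order sum through 1 /
     (k + t) <= 1 / k. *)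
  apply: (@eqaddO_bound _ _ _ _ _ _ (t * (t + 1) + t ^+ 2)).
    by rewrite addr_gt0 ?exprn_gt0 ?mulr_gt0 ?addr_gt0.
  apply: nearD => n k k0 kn.
  have K0 : 0 < k%:R :> R by rewrite ltr0n.
  have N0 : 0 <= n%:R :> R by [].
  rewrite VE//= (@ger0_norm _ k%:R^-1) ?invr_ge0//.
  have /andP[B C] := gen_harmonic2B_bound t1 kn.
  rewrite (_ : _ - _ - _ = t * (H n t - H k t - ln (n%:R / k%:R))
    - t ^+ 2 * (H2 n t - H2 k t)); last by ring.
  rewrite (le_trans (ler_normB _ _))// mulrDl lerD//.
    by rewrite normrM gtr0_norm// -mulrA ler_pM2l// harmonicB_ln// ltW.
  rewrite ger0_norm ?mulr_ge0 ?exprn_ge0 ?(ltW t0)// ler_pM2l ?exprn_gt0//.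
  rewrite (le_trans C)// (@le_trans _ _ (k%:R + t)^-1)//.
    by rewrite gerBl invr_ge0 addr_ge0// ltW.
  by rewrite lef_pV2 ?posrE ?addr_gt0// lerDl ltW.
Unshelve. all: by end_near. Qed.
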